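(* Let $\ell \geq 2$ be an integer. The constant $\Big[\frac{(2\ell)!}{4^{\ell}\ell!}\Big]^2$ is optimal in the inequality $$\sum_{n\in\mathbb{N},\;2n \geq \ell } |(\Delta^{\ell/2}u)_n|^2 \geq \Big[\frac{(2\ell)!}{4^\ell\ell!}\Big]^2\sum_{n= \ell}^\infty \frac{u_n^2}{n^{2\ell}},\qquad u\in C_c(\mathbb{N}),\ u_k=0 \text{ for } 0\le k\le \ell-1,$$ that is, for no constant $\lambda > \Big[\frac{(2\ell)!}{4^{\ell}\ell!}\Big]^2$ does the inequality $$\sum_{n\in\mathbb{N},\;2n \geq \ell } |(\Delta^{\ell/2}u)_n|^2 \geq \lambda\sum_{n= \ell}^\infty \frac{u_n^2}{n^{2\ell}}$$ hold for all $u\in C_c(\mathbb{N})$ satisfying $u_k = 0$ for $0 \leq k \leq \ell - 1$.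
   Context: $\mathbb{N}=\{0,1,2,\dots\}$ and $C_c(\mathbb{N})$ is the space of finitely supported real sequences $u=(u_n)_{n\in\mathbb{N}}$. The discrete gradient is $(\nabla u)_n = u_n-u_{n-1}$ and the discrete Laplacian is $(\Delta u)_n = 2u_n-u_{n+1}-u_{n-1}$ (each defined at those $n$ for which all indices involved are available). For even $\ell=2m$, $\Delta^{\ell/2}=\Delta^m$; for odd $\ell=2m+1$, $\Delta^{\ell/2}$ means $\nabla\Delta^{m}$. With these conventions $(\Delta^{\ell/2}u)_n$ is well defined from the values $u_j$, $j\ge 0$, whenever $2n\geq \ell$. *)

(* Defs.v *)
From HB Require Import structures.
From mathcomp Require Import all_boot all_order all_algebra.
From mathcomp Require Import all_classical all_reals all_analysis.

Set Implicit Arguments.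
Unset Strict Implicit.
Unset Printing Implicit Defensive.
Import Order.TTheory GRing.Theory Num.Theory.

Local Open Scope classical_set_scope.
Local Open Scope ring_scope.

Definition finitely_supported (R : realType) (u : nat -> R) : Prop :=
  finite_set [set n | u n != 0].

(* The operators below are made total by the convention 0.-1 = 0, so their
   values at n = 0 are meaningless.  The value at n of the l-th half-power
   [lap_half l u] is the intended one, i.e. it does not involve these junk
   values, exactly when l <= 2n. *)

Definition grad (R : realType) (u : nat -> R) : nat -> R :=
  fun n => u n - u n.-1.

Definition lap (R : realType) (u : nat -> R) : nat -> R :=
  fun n => 2 * u n - u n.+1 - u n.-1.

Definition lap_half (R : realType) (l : nat) (u : nat -> R) : nat -> R :=
  if odd l then grad (iter l./2 (@lap R) u) else iter l./2 (@lap R) u.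

Definition hardy_const (R : realType) (l : nat) : R :=
  ((2 * l)`!%:R / (4 ^+ l * l`!%:R)) ^+ 2.

(* Main.v *)
Require Import Defs.
From HB Require Import structures.
From mathcomp Require Import all_boot all_order all_algebra.
From mathcomp Require Import all_classical all_reals all_analysis.
From mathcomp Require Import zify ring lra.

Set Implicit Arguments.
Unset Strict Implicit.
Unset Printing Implicit Defensive.
Import Order.TTheory GRing.Theory Num.Theory.

Local Open Scope classical_set_scope.
Local Open Scope ring_scope.

(** Differencing lowers by one the exponent of the binomial series
    (1 - x)^-(j + 1/2).  Hence, for p_n the coefficient of x^(n - l) in
    (1 - x)^-(l + 1/2), the square of the l-th difference of p at n = m + l is
    the square a_m^2 of the m-th coefficient of (1 - x)^(-1/2), which is of
    order 1/m, while the Hardy term hardy_const * p_n^2 / n^(2l) is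
    a_m^2 (1 + O(1/m)).  So p is a near-optimiser with
    logarithmically divergent energy.  Multiplying p by the polynomial cutoff
    C(Y - n, l + 1) / C(Y, l + 1) changes both sums over n < Y by amounts bounded
    independently of Y, so no larger constant survives Y -> oo. *)

(** * Iterated differences and half powers of the Laplacian *)

Lemma iter_gradD (R : realType) (u v : nat -> R) j n :
  iter j (@grad R) (fun k => u k + v k) n
    = iter j (@grad R) u n + iter j (@grad R) v n.
Proof. by elim: j n => //= j IH n; rewrite /grad !IH; ring. Qed.

Lemma iter_grad_predn (R : realType) (u : nat -> R) j n :
  iter j (@grad R) (fun k => u k.-1) n = iter j (@grad R) u n.-1.
Proof. by elim: j n => //= j IH n; rewrite /grad !IH. Qed.

Lemma gradM (R : realType) (f g : nat -> R) :
  grad (fun k => f k * g k)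
    = (fun k => grad f k * g k + f k.-1 * grad g k).
Proof. by apply/funext => k; rewrite /grad; ring. Qed.

(** Applying the Leibniz rule [gradM] [l] times gives [2 ^+ l] terms. One of them is the subtracted
    term, and each of the others puts at least one difference on [g]. The shifts fall on [f] only,
    hence the bound on [f] at every [k <= n] but on [g] at [n] alone. *)
Lemma iter_gradM_sub (R : realType) l (f g : nat -> R) n (B : R) :
  (forall i k, (i < l)%N -> (k <= n)%N ->
     `|iter i (@grad R) f k| * `|iter (l - i) (@grad R) g n| <= B) ->
  `|iter l (@grad R) (fun k => f k * g k) n - iter l (@grad R) f n * g n|
     <= (2 ^+ l - 1) * B.
Proof.
elim: l f g => [|l IH] f g H.
  by rewrite /= subrr normr0 expr0 subrr mul0r.
rewrite !iterSr gradM iter_gradD.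
have H1 : forall i k, (i < l)%N -> (k <= n)%N ->
    `|iter i (@grad R) (grad f) k| * `|iter (l - i) (@grad R) g n| <= B.
  by move=> i k il kn; rewrite -iterSr -subSS; exact: H.
have H2 : forall i k, (i < l)%N -> (k <= n)%N ->
    `|iter i (@grad R) (fun k => f k.-1) k|
      * `|iter (l - i) (@grad R) (grad g) n| <= B.
  move=> i k il kn; rewrite -iterSr -subSn 1?ltnW// iter_grad_predn.
  by apply: H; [exact: leqW | exact: leq_trans (leq_pred _) kn].
have H3 : `|iter l (@grad R) (fun k => f k.-1) n * grad g n| <= B.
  rewrite normrM iter_grad_predn.
  by have := H l n.-1 (ltnSn l) (leq_pred n); rewrite subSnn.
have := IH _ _ H1; have := IH _ _ H2.
move: (iter _ _ _ _) (iter _ _ _ _) (iter _ _ _ _) H3 => x y z H3.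
rewrite exprS; move: (2 ^+ l) => t; rewrite !ler_norml in H3 *.
by move=> /andP[? ?] /andP[? ?]; case/andP: H3 => ? ?; apply/andP; split; lra.
Qed.

Lemma iter_grad_shift_eq0 (R : realType) (u : nat -> R) N j n :
  (forall k, (N <= k)%N -> u k = 0) -> (N + j <= n)%N ->
  iter j (@grad R) u n = 0.
Proof.
move=> uN; elim: j n => [|j IH] n Nn /=; first by rewrite uN// -(addn0 N).
by rewrite /grad !IH ?subrr//; lia.
Qed.

(** One Laplacian at [n] is minus the second backward difference at [n + 1]; with [m <= n] the
    convention [0.-1 = 0] stays out of play. *)
Lemma iter_lapE (R : realType) (u : nat -> R) m n : (m <= n)%N ->
  iter m (@lap R) u n = (-1) ^+ m * iter m.*2 (@grad R) u (n + m)%N.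
Proof.
elim: m n => [|m IH] n mn; first by rewrite expr0 mul1r addn0.
rewrite doubleS !iterS /lap !IH; [|lia..].
rewrite /grad !addnS /= exprS.
have -> : (n.-1 + m = (n + m).-1)%N by lia.
by rewrite addSn; ring.
Qed.

Lemma lap_half_grad (R : realType) (u : nat -> R) l n : (l <= n.*2)%N ->
  `|lap_half l u n| = `|iter l (@grad R) u (n + l./2)%N|.
Proof.
move=> ln; rewrite /lap_half; have lE := odd_double_half l.
have -> : iter l (@grad R) u = iter (odd l + l./2.*2) (@grad R) u by rewrite lE.
case: ifP => [lo|le]; last first.
  rewrite le in lE; rewrite iter_lapE; last by lia.
  by rewrite normrM normrX normrN normr1 expr1n mul1r.
(* For odd [l], [l <= n.*2] gives [l./2 <= n.-1], so the previous lemma applies at both [n] and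
   [n.-1]. *)
rewrite lo in lE; rewrite iterS /grad !iter_lapE; [|lia..].
have -> : (n.-1 + l./2 = (n + l./2).-1)%N by lia.
by rewrite -mulrBr normrM normrX normrN normr1 expr1n mul1r.
Qed.

(** * Coefficients of the binomial series *)

(* The coefficient of x^m in (1 - x)^-(j + 1/2). *)
Definition hbin (R : realType) (j m : nat) : R :=
  \prod_(i < m) ((2 * i + 2 * j + 1)%:R / (2 * i + 2)%:R).

Lemma hbin0 (R : realType) j : hbin R j 0 = 1.
Proof. by rewrite /hbin big_ord0. Qed.

Lemma hbinS (R : realType) j m :
  hbin R j m.+1 = hbin R j m * ((2 * m + 2 * j + 1)%:R / (2 * m + 2)%:R).
Proof. by rewrite /hbin big_ord_recr. Qed.

Lemma hbin_gt0 (R : realType) j m : 0 < hbin R j m.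
Proof.
by apply: prodr_gt0 => i _; rewrite divr_gt0// ltr0n; lia.
Qed.

(** The quotient of the two products telescopes, its factors being (2i + 2j + 3) / (2i + 2j + 1). *)
Lemma hbin_succl (R : realType) j m :
  hbin R j.+1 m * (2 * j + 1)%:R = hbin R j m * (2 * m + 2 * j + 1)%:R.
Proof.
elim: m => [|m IH]; first by rewrite !hbin0 muln0.
rewrite !hbinS mulrAC IH.
have m0 : 0 <= m%:R :> R by [].
by rewrite !natrD !natrM -!natr1; field; rewrite gt_eqF//; lra.
Qed.

(** Compare coefficients in (1 - x) (1 - x)^-(j + 3/2) = (1 - x)^-(j + 1/2). *)
Lemma hbin_pascal (R : realType) j m :
  hbin R j.+1 m.+1 - hbin R j.+1 m = hbin R j m.+1.
Proof.
have m0 : 0 <= m%:R :> R by [].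
rewrite !hbinS.
transitivity ((hbin R j.+1 m * (2 * j + 1)%:R) / (2 * m + 2)%:R); last first.
  by rewrite hbin_succl mulrA.
by rewrite !natrD !natrM -!natr1; field; rewrite gt_eqF//; lra.
Qed.

Lemma sum_hbin (R : realType) j m : \sum_(i < m.+1) hbin R j i = hbin R j.+1 m.
Proof.
elim: m => [|m IH]; first by rewrite big_ord_recr big_ord0 /= add0r !hbin0.
by rewrite big_ord_recr /= IH -hbin_pascal; ring.
Qed.

Lemma hbin_homo (R : realType) j : {homo hbin R j.+1 : m n / (m <= n)%N >-> m <= n}.
Proof.
apply: (homo_leq (r := fun x y : R => x <= y)) => [//|y x z /le_trans|i]; first exact.
by rewrite -subr_ge0 hbin_pascal ltW// hbin_gt0.
Qed.

(** By [hbin_succl], raising the index from [i] to [i + 1] costs a factor (2m + 2i + 1) / (2i + 1),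
    at most [y]. *)
Lemma hbin_ub (R : realType) j m (y : R) :
  (2 * (m + j))%:R <= y -> hbin R j m <= hbin R 0 m * y ^+ j.
Proof.
elim: j => [|j IH] h; first by rewrite expr0 mulr1.
have j0 : 1 <= (2 * j + 1)%:R :> R by rewrite ler1n addn1.
apply: (@le_trans _ _ (hbin R j.+1 m * (2 * j + 1)%:R)).
  by rewrite ler_peMr// ltW// hbin_gt0.
rewrite hbin_succl exprSr mulrA.
apply: ler_pM; [exact/ltW/hbin_gt0 | exact: ler0n | | ].
  by apply: IH; apply: le_trans h; rewrite ler_nat; lia.
by apply/ltW; apply: lt_le_trans h; rewrite ltr_nat; lia.
Qed.

Lemma natrDM (R : realType) a b c : (a * b + c)%:R = a%:R * b%:R + c%:R :> R.
Proof. by rewrite natrD natrM. Qed.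

(** With a_m = [hbin R 0 m], the sequence (m + 1) a_m^2 starts at 1 and does not increase. *)
Lemma hbin0_sqr_ub (R : realType) m : hbin R 0 m ^+ 2 <= m.+1%:R^-1.
Proof.
elim: m => [|m IH]; first by rewrite hbin0 expr1n invr1.
rewrite hbinS exprMn muln0 addn0.
apply: (@le_trans _ _ (m.+1%:R^-1 * ((2 * m + 1)%:R / (2 * m + 2)%:R) ^+ 2)).
  by rewrite ler_wpM2r// sqr_ge0.
rewrite -subr_ge0.
have m0 : 0 <= m%:R :> R by [].
rewrite !natrDM -!natr1.
move: m0; set x : R := m%:R; clearbody x => m0.
set a := (X in 0 <= X).
have -> : a = (3 * x + 2) / ((x + 1 + 1) * (x + 1) * (2 * x + 2) ^+ 2).
  by rewrite /a; field; rewrite !gt_eqF//; lra.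
by rewrite divr_ge0 ?mulr_ge0 ?sqr_ge0//; lra.
Qed.

(** The sequence m a_m^2 starts at 1/4 for m = 1 and does not decrease. *)
Lemma hbin0_sqr_lb (R : realType) m : (4 * m.+1%:R)^-1 <= hbin R 0 m.+1 ^+ 2.
Proof.
elim: m => [|m IH].
  by rewrite hbinS hbin0 mul1r mulr1 !muln0 !add0n; lra.
rewrite hbinS exprMn muln0 addn0.
apply: (@le_trans _ _ ((4 * m.+1%:R)^-1 *
    ((2 * m.+1 + 1)%:R / (2 * m.+1 + 2)%:R) ^+ 2)); last first.
  by rewrite ler_wpM2r// sqr_ge0.
rewrite -subr_ge0.
have m0 : 0 <= m%:R :> R by [].
rewrite !natrDM -!natr1.
move: m0; set x : R := m%:R; clearbody x => m0.
set a := (X in 0 <= X).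
have -> : a = 1 / (4 * (x + 1) * (2 * (x + 1) + 2) ^+ 2).
  by rewrite /a; field; rewrite !gt_eqF//; lra.
by rewrite divr_ge0 ?mulr_ge0 ?sqr_ge0//; lra.
Qed.

(** The root of the Hardy constant is the product of the i + 1/2 over i < l, exactly the
    denominators met when [hbin_succl] is iterated from 0 to [l]. *)
Lemma hardy_root_hbin (R : realType) l m :
  (2 * l)`!%:R / (4 ^+ l * l`!%:R) * hbin R l m
    = hbin R 0 m * \prod_(i < l) (m%:R + i%:R + 2^-1).
Proof.
elim: l => [|l IH].
  by rewrite big_ord0 muln0 !fact0 expr0 mulr1 divr1 mul1r mulr1.
rewrite big_ord_recr /= [RHS]mulrA -IH.
have := hbin_succl R l m.
move: (hbin R l.+1 m) (hbin R l m) => a b.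
have -> : (2 * l.+1 = (2 * l).+2)%N by lia.
have -> : (2 * m + 2 * l + 1)%:R = 2 * m%:R + 2 * l%:R + 1 :> R.
  by rewrite addn1 -natr1 !natrDM natrM.
rewrite !factS natrDM exprS (natrM R _.+2) (natrM R _.+1) (natrM R l.+1).
rewrite -(addn2 (2 * l)) -(addn1 (2 * l)) -(addn1 l) (natrD R l) !natrDM.
have f1 : (l`!)%:R != 0 :> R by rewrite pnatr_eq0 -lt0n fact_gt0.
have f2 : 4 ^+ l != 0 :> R by rewrite expf_neq0.
have l0 : 0 <= l%:R :> R by [].
move: f1 f2 l0; move: (l`!%:R) (4 ^+ l) ((2 * l)`!%:R) (l%:R) => f t g x f1 f2 x0 H.
have -> : a = b * (2 * m%:R + 2 * x + 1) / (2 * x + 1).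
  by rewrite -H mulfK// gt_eqF//; lra.
by field; rewrite f1 f2 !gt_eqF//; lra.
Qed.

(** * The untruncated test sequence and the polynomial cutoff *)

Definition test_base (R : realType) (l n : nat) : R :=
  if (n < l)%N then 0 else hbin R l (n - l).

Lemma iter_grad_test_base (R : realType) l j n : (j <= l)%N ->
  iter j (@grad R) (test_base R l) n
    = if (n < l)%N then 0 else hbin R (l - j) (n - l).
Proof.
elim: j n => [|j IH] n jl; first by rewrite subn0.
rewrite iterS /grad !(IH _ (ltnW jl)).
have -> : (l - j = (l - j.+1).+1)%N by lia.
case: (ltnP n l) => nl; first by rewrite ifT ?subrr//; lia.
(* The jump from 0 to 1 at [n = l] reproduces itself at each order, since every [hbin R j 0] is
   1. *)
have [nl'|nl'] := eqVneq n l.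
  by rewrite nl' subnn !hbin0 ifT ?subr0//; lia.
rewrite ifF; last by lia.
have -> : (n - l = (n.-1 - l).+1)%N by lia.
exact: hbin_pascal.
Qed.

(** A discrete (1 - n/Y)^L. Binomials are used because their differences are again binomials; for
    [L > 0] truncated subtraction gives 0 once [n > Y - L]. *)
Definition cutoff (R : realType) (L Y n : nat) : R :=
  'C(Y - n, L)%:R / 'C(Y, L)%:R.

Lemma iter_grad_cutoff (R : realType) L Y j n : (j < L)%N -> (j <= n)%N ->
  iter j (@grad R) (cutoff R L Y) n
    = (-1) ^+ j * ('C(Y - n, L - j)%:R / 'C(Y, L)%:R).
Proof.
elim: j n => [|j IH] n jL jn; first by rewrite /= mul1r subn0.
rewrite iterS /grad !IH; [|lia..].
rewrite -mulrBr exprS mulN1r mulNr -mulrN -mulrBl -mulNr; congr (_ * (_ * _)).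
have -> : (L - j = (L - j.+1).+1)%N by lia.
have [nY|Yn] := leqP n Y.
  have -> : (Y - n.-1 = (Y - n).+1)%N by lia.
  by rewrite binS natrD; ring.
(* Past [Y] everything vanishes: the lower index [L - j.+1] is still positive, which is where
   strictness in [j < L] enters. *)
have -> : (Y - n = 0)%N by lia.
have -> : (Y - n.-1 = 0)%N by lia.
by rewrite subrr bin0n (_ : (_ == _)%N = false) ?oppr0//; lia.
Qed.

(** Lowering the lower index from k + 1 to k multiplies the binomial by (k + 1) / (Y - k), where k +
    1 <= L and Y - k >= Y / 2. *)
Lemma bin_ratio_ub (R : realType) L Y j : (0 < L)%N -> (2 * L <= Y)%N -> (j <= L)%N ->
  'C(Y, L - j)%:R / 'C(Y, L)%:R <= (2 * L%:R / Y%:R) ^+ j :> R.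
Proof.
move=> L0 LY; elim: j => [|j IH] jL.
  by rewrite subn0 divff// pnatr_eq0 -lt0n bin_gt0; lia.
have Y0 : 0 < Y%:R :> R by rewrite ltr0n; lia.
have C0 : 0 < 'C(Y, L)%:R :> R by rewrite ltr0n bin_gt0; lia.
apply: (@le_trans _ _ ((2 * L%:R / Y%:R) *
    ('C(Y, L - j)%:R / 'C(Y, L)%:R))); last first.
  by rewrite exprS ler_wpM2l ?IH ?divr_ge0 ?mulr_ge0//; lia.
rewrite mulrA ler_pM2r ?invr_gt0// mulrAC ler_pdivlMr// -!natrM ler_nat.
have -> : (L - j = (L - j.+1).+1)%N by lia.
have := mul_bin_left Y (L - j.+1).
set hi := 'C(_, _.+1); set lo := 'C(_, _) => e.
have : ((Y - (L - j.+1)) * lo <= L * hi)%N.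
  by rewrite -e leq_mul2r; apply/orP; right; lia.
have : (lo * Y <= 2 * ((Y - (L - j.+1)) * lo))%N.
  by rewrite mulnA [leqLHS]mulnC leq_mul2r; apply/orP; right; lia.
lia.
Qed.

Lemma iter_grad_cutoff_le (R : realType) L Y j n :
  (2 * L <= Y)%N -> (j < L)%N -> (j <= n)%N ->
  `|iter j (@grad R) (cutoff R L Y) n| <= (2 * L%:R / Y%:R) ^+ j.
Proof.
move=> LY jL jn; rewrite iter_grad_cutoff// normrM normrX normrN normr1 expr1n mul1r.
rewrite ger0_norm ?divr_ge0//.
apply: le_trans (bin_ratio_ub R _ LY (ltnW jL)); last by lia.
by rewrite ler_wpM2r ?invr_ge0// ler_nat leq_bin2l// leq_subr.
Qed.

Lemma cutoff_ge0 (R : realType) L Y n : 0 <= cutoff R L Y n.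
Proof. by rewrite divr_ge0. Qed.

Lemma cutoff_le1 (R : realType) L Y n : (L <= Y)%N -> cutoff R L Y n <= 1.
Proof.
move=> LY; rewrite ler_pdivrMr ?mul1r ?ler_nat ?leq_bin2l ?leq_subr//.
by rewrite ltr0n bin_gt0.
Qed.

(** The cutoff starts at 1 and each step lowers it by at most 2L / Y. *)
Lemma cutoff_ge (R : realType) L Y n : (1 < L)%N -> (2 * L <= Y)%N ->
  1 - n%:R * (2 * L%:R / Y%:R) <= cutoff R L Y n.
Proof.
move=> L1 LY; elim: n => [|n IH].
  by rewrite mul0r subr0 /cutoff subn0 divff// pnatr_eq0 -lt0n bin_gt0; lia.
have := iter_grad_cutoff_le R LY L1 (ltn0Sn n).
by rewrite /= /grad /= expr1 ler_norml => /andP[+ _]; rewrite -natr1; lra.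
Qed.

(** Order [l.+1] keeps all differences up to order [l] within reach of [iter_grad_cutoff]; the
    length [M.+1 + l] makes the product vanish beyond [M]. *)
Definition trial (R : realType) (l M n : nat) : R :=
  test_base R l n * cutoff R l.+1 (M.+1 + l) n.

Lemma trial_eq0_lt (R : realType) l M n : (n < l)%N -> trial R l M n = 0.
Proof. by move=> nl; rewrite /trial /test_base nl mul0r. Qed.

Lemma trial_eq0_ge (R : realType) l M n : (M < n)%N -> trial R l M n = 0.
Proof.
by move=> Mn; rewrite /trial /cutoff bin_small ?mul0r ?mulr0//; lia.
Qed.

(** * Upper bound for the energy of the trial sequence *)

(** In a Leibniz error term with [l - i] differences on the cutoff, the base contributes at most a_M
    (2Y)^(l - i) and the cutoff at most (2(l + 1) / Y)^(l - i), so the powers of Y cancel. *)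
Lemma trial_grad_ub (R : realType) l M m : (l < M)%N -> (m <= M)%N ->
  `|iter l (@grad R) (trial R l M) (m + l)%N|
    <= hbin R 0 m + hbin R 0 M * (8 * l.+1%:R) ^+ l.
Proof.
move=> lM mM; set a := hbin R 0 M.
have a0 : 0 < a by exact: hbin_gt0.
set Y := (M.+1 + l)%N.
have Y0 : 0 < Y%:R :> R by rewrite ltr0n.
have L1 : 1 <= 4 * l.+1%:R :> R by rewrite -natrM ler1n.
set p := test_base R l; set g := cutoff R l.+1 Y.
have pg : `|iter l (@grad R) (fun k => p k * g k) (m + l)%N
    - iter l (@grad R) p (m + l)%N * g (m + l)%N|
    <= (2 ^+ l - 1) * (a * (4 * l.+1%:R) ^+ l).
  apply: iter_gradM_sub => i k il kml.
  (* A positive index is needed: [hbin_homo] gives monotonicity for [hbin R j.+1], while [hbin R 0]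
     decreases. *)
  have [j jE] : exists j, (l - i = j.+1)%N by exists (l - i).-1; lia.
  apply: (@le_trans _ _ ((a * (2 * Y%:R) ^+ j.+1) * (2 * l.+1%:R / Y%:R) ^+ j.+1)).
    rewrite jE; apply: ler_pM => //; last by apply: iter_grad_cutoff_le; lia.
    rewrite (iter_grad_test_base _ _ (ltnW il)); case: ifP => kl.
      by rewrite normr0 mulr_ge0 ?exprn_ge0 ?mulr_ge0 ?ltW.
    rewrite jE ger0_norm ?(ltW (hbin_gt0 _ _ _))//.
    apply: (@le_trans _ _ (hbin R j.+1 M)); first by apply: hbin_homo; lia.
    by apply: hbin_ub; rewrite -natrM ler_nat /Y; lia.
  rewrite -mulrA -exprMn.
  have -> : 2 * Y%:R * (2 * l.+1%:R / Y%:R) = 4 * l.+1%:R :> R.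
    by field; rewrite gt_eqF.
  by rewrite ler_pM2l// ler_weXn2l//; lia.
have gl1 : g (m + l)%N <= 1 by apply: cutoff_le1; rewrite /Y; lia.
have g0 : 0 <= g (m + l)%N by exact: cutoff_ge0.
have E0 : 0 <= a * (4 * l.+1%:R) ^+ l.
  by rewrite mulr_ge0 ?ltW ?exprn_gt0//; apply: lt_le_trans L1.
have -> : (8 * l.+1%:R) ^+ l = 2 ^+ l * (4 * l.+1%:R) ^+ l :> R.
  by rewrite -exprMn; congr (_ ^+ _); ring.
move: pg; rewrite iter_grad_test_base// subnn addnK ifF; last by lia.
rewrite -[iter l _ (fun k => p k * g k) _]/(iter l (@grad R) (trial R l M) _).
move: (iter l _ _ _) => x.
have h0 : 0 < hbin R 0 m by exact: hbin_gt0.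
have hg : hbin R 0 m * g (m + l)%N <= hbin R 0 m by rewrite ler_piMr// ltW.
have hg0 : 0 <= hbin R 0 m * g (m + l)%N by rewrite mulr_ge0// ltW.
rewrite mulrBl mul1r [a * (_ * _)]mulrCA.
move: hg hg0 E0 h0; move: (hbin R 0 m) (hbin R 0 m * _) (a * _) => h y e.
move=> hg hg0 e0 h0; rewrite !ler_norml => /andP[? ?].
by apply/andP; split; lra.
Qed.

(** Squaring a_m + a_M E leaves a cross sum 2 E a_M^2 (2M + 1), by [sum_hbin], and a tail (M + 1)
    a_M^2 E^2. Since (M + 1) a_M^2 <= 1, both are bounded independently of [M]. *)
Lemma sum_trial_grad_ub (R : realType) l M : (l < M)%N ->
  \sum_(m < M.+1) `|iter l (@grad R) (trial R l M) (m + l)%N| ^+ 2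
    <= \sum_(m < M.+1) hbin R 0 m ^+ 2
       + (4 * (8 * l.+1%:R) ^+ l + ((8 * l.+1%:R) ^+ l) ^+ 2).
Proof.
move=> lM; set E := (8 * l.+1%:R) ^+ l; set a := hbin R 0 M.
have E0 : 0 <= E by rewrite exprn_ge0.
have a0 : 0 < a by exact: hbin_gt0.
have a2 : a ^+ 2 * M.+1%:R <= 1 by rewrite -ler_pdivlMr ?div1r ?hbin0_sqr_ub.
apply: (@le_trans _ _ (\sum_(m < M.+1)
    (hbin R 0 m ^+ 2 + 2 * E * a * hbin R 0 m + (E * a) ^+ 2))).
  apply: ler_sum => m _.
  apply: (@le_trans _ _ ((hbin R 0 m + a * E) ^+ 2)).
    by rewrite lerXn2r ?nnegrE ?addr_ge0 ?mulr_ge0 ?(ltW (hbin_gt0 _ _ _))//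
      trial_grad_ub -1?ltnS.
  by rewrite le_eqVlt; apply/orP; left; apply/eqP; ring.
rewrite !big_split /= -mulr_sumr sum_hbin sumr_const card_ord -addrA lerD2l.
have -> : hbin R 1 M = a * (2 * M%:R + 1).
  by have := hbin_succl R 0 M; rewrite muln0 addn0 mulr1 natrDM.
apply: lerD.
  rewrite (_ : 2 * E * a * _ = (2 * E) * (a ^+ 2 * (2 * M%:R + 1))); last by ring.
  rewrite (_ : 4 * E = (2 * E) * 2); last by ring.
  rewrite ler_wpM2l ?mulr_ge0//.
  have := sqr_ge0 a; move: a2; rewrite -natr1; move: (a ^+ 2) => b; nra.
by rewrite -mulr_natr exprMn -mulrA ler_piMr ?sqr_ge0.
Qed.

(** * Lower bound for the Hardy sum of the trial sequence *)

Lemma prod_ratio_bounds (R : realType) (l m k : nat) : (0 < l)%N -> (k <= l)%N ->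
  let P := \prod_(i < k) ((m%:R + i%:R + 2^-1) / (m + l)%:R) in
  [/\ 0 <= P, P <= 1 & 1 - k%:R * (l%:R / (m + l)%:R) <= P :> R].
Proof.
move=> l0 kl.
have n0 : 0 < (m + l)%:R :> R by rewrite ltr0n addn_gt0 l0 orbT.
elim: k kl => [|k IH] kl /=.
  by rewrite big_ord0 mul0r subr0.
have [P0 P1 P2] := IH (ltnW kl).
rewrite big_ord_recr /=.
move: P0 P1 P2; move: (\prod_(i < k) _) => P P0 P1 P2.
set t := (m%:R + _ + _) / _.
have t0 : 0 <= t by rewrite divr_ge0.
have t1 : t <= 1.
  rewrite ler_pdivrMr// mul1r natrD.
  by have : k.+1%:R <= l%:R :> R; [rewrite ler_nat | rewrite -natr1; lra].
have t2 : 1 - l%:R / (m + l)%:R <= t.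
  rewrite -[X in X - _](divff (lt0r_neq0 n0)) -mulrBl ler_pM2r ?invr_gt0//.
  have : 0 <= k%:R :> R by [].
  by rewrite natrD; lra.
split; first exact: mulr_ge0.
  by rewrite mulr_ile1.
(* This is P t >= P + t - 1: the defects of factors in [0, 1] at most add up. *)
have : 0 <= (1 - P) * (1 - t) by rewrite mulr_ge0 ?subr_ge0.
move: P2 t2; rewrite -natr1; move: (l%:R / _) => d; nra.
Qed.

Lemma sum_trial_lb (R : realType) l M : (1 < l)%N -> (l < M)%N ->
  \sum_(m < M.+1) hbin R 0 m ^+ 2 - (4 * l%:R * l.+1%:R + 2 * l%:R ^+ 2)
  <= hardy_const R l * \sum_(m < M.+1)
       (trial R l M (m + l)%N ^+ 2 / (m + l)%:R ^+ (2 * l)).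
Proof.
move=> l1 lM; set Y := (M.+1 + l)%N; set d : R := 2 * l.+1%:R / Y%:R.
have Y0 : 0 < Y%:R :> R by rewrite ltr0n.
have d0 : 0 <= d by rewrite divr_ge0.
have dM : d * M.+1%:R <= 2 * l.+1%:R.
  by rewrite /d mulrAC ler_pdivrMr// ler_wpM2l// ler_nat /Y leq_addr.
(* The loss per term splits into a constant of order 1/Y, due to the cutoff, and a telescoping part,
   due to replacing the product of the m + i + 1/2 by n^l. *)
apply: (@le_trans _ _ (\sum_(m < M.+1) (hbin R 0 m ^+ 2
    - (2 * l%:R * d + 2 * l%:R ^+ 2 * (m.+1%:R^-1 - m.+2%:R^-1))))).
  rewrite sumrB lerD2l lerN2 big_split /= sumr_const card_ord -mulr_sumr.
  apply: lerD.
    rewrite -(mulr_natr _ M.+1) -[leLHS]mulrA (_ : 4 * _ * _ = 2 * l%:R * (2 * l.+1%:R)).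
      by rewrite ler_wpM2l ?mulr_ge0.
    by ring.
  rewrite ler_piMr ?mulr_ge0 ?sqr_ge0//.
  rewrite -(big_mkord xpredT (fun m => m.+1%:R^-1 - m.+2%:R^-1 : R)).
  rewrite (@telescope_sumr_eq _ 0 M.+1 (fun m => - m.+1%:R^-1)) ?opprK ?invr1; first last.
  - by move=> k _; rewrite opprK addrC.
  - by [].
  by rewrite addrC gerBl invr_ge0.
rewrite mulr_sumr; apply: ler_sum => m _.
set n := (m + l)%N.
have n0 : 0 < n%:R :> R by rewrite ltr0n /n; lia.
have [] := @prod_ratio_bounds R l m l (ltnW l1) (leqnn l).
set r := \prod_(i < l) _ => r0 r1 r2.
have rE : \prod_(i < l) (m%:R + i%:R + 2^-1) = r * n%:R ^+ l.
  by rewrite /r prodf_div prodr_const card_ord divfK// expf_neq0// gt_eqF.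
have gl1 : cutoff R l.+1 Y n <= 1 by apply: cutoff_le1; rewrite /Y; lia.
have g0 : 0 <= cutoff R l.+1 Y n by exact: cutoff_ge0.
have g2 : 1 - n%:R * d <= cutoff R l.+1 Y n.
  by apply: cutoff_ge; rewrite /Y; lia.
have -> : hardy_const R l * (trial R l M n ^+ 2 / n%:R ^+ (2 * l))
    = hbin R 0 m ^+ 2 * (cutoff R l.+1 Y n * r) ^+ 2.
  rewrite /hardy_const /trial /test_base ifF; last by rewrite /n; lia.
  have -> : n%:R ^+ (2 * l) = (n%:R ^+ l) ^+ 2 :> R by rewrite mulnC exprM.
  rewrite addnK.
  have := hardy_root_hbin R l m; rewrite rE => H.
  rewrite -/Y; move: (cutoff _ _ _ _) => c.
  rewrite -expr_div_n -!exprMn !mulrA H; congr (_ ^+ 2); field.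
  by rewrite expf_neq0// gt_eqF.
set g := cutoff R l.+1 Y n in gl1 g0 g2 *.
(* Here 1 - (g r)^2 <= 2 (1 - g r) <= 2 (1 - g) + 2 (1 - r). *)
have q : 1 - (g * r) ^+ 2 <= 2 * (n%:R * d) + 2 * (l%:R * (l%:R / n%:R)).
  have : 0 <= (1 - g) * (1 - r) by rewrite mulr_ge0 ?subr_ge0.
  have := sqr_ge0 (1 - g * r).
  by move: g2 r2; rewrite -/n; move: (n%:R * d) (l%:R * _) => x y; nra.
have m1 : 0 < m.+1%:R^-1 :> R by rewrite invr_gt0.
have h1 : hbin R 0 m ^+ 2 * (1 - (g * r) ^+ 2)
    <= m.+1%:R^-1 * (2 * (n%:R * d) + 2 * (l%:R * (l%:R / n%:R))).
  apply: le_trans (ler_wpM2l (sqr_ge0 _) q) _.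
  by rewrite ler_wpM2r ?hbin0_sqr_ub// addr_ge0 ?mulr_ge0 ?invr_ge0.
have h2 : m.+1%:R^-1 * n%:R <= l%:R :> R.
  by rewrite mulrC ler_pdivrMr// -natrM ler_nat /n; nia.
have h3 : m.+1%:R^-1 * n%:R^-1 <= m.+1%:R^-1 - m.+2%:R^-1 :> R.
  have -> : m.+1%:R^-1 - m.+2%:R^-1 = m.+1%:R^-1 * m.+2%:R^-1 :> R.
    have : m.+1%:R != 0 :> R by [].
    have : m.+2%:R != 0 :> R by [].
    by rewrite -(natr1 m.+1); move: (m.+1%:R) => x x0 x1; field; rewrite x0 x1.
  (* The assumption [1 < l] enters here. *)
  have mn : (m.+2 <= n)%N by rewrite -addn2 leq_add2l.
  rewrite (ler_pM2l m1).
  by rewrite lef_pV2 ?posrE ?ltr0Sn// ler_nat.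
have h4 := ler_wpM2r d0 h2.
have h5 := ler_wpM2l (sqr_ge0 (l%:R : R)) h3.
rewrite lerBlDr -lerBlDl -[X in X - _]mulr1 -mulrBr.
apply: le_trans h1 _; rewrite mulrDr.
apply: lerD.
  rewrite (_ : _ * (2 * _) = 2 * (m.+1%:R^-1 * n%:R * d)); last by ring.
  by rewrite -[leRHS]mulrA ler_wpM2l.
rewrite (_ : _ * (2 * _) = 2 * (l%:R ^+ 2 * (m.+1%:R^-1 * n%:R^-1))); last by ring.
by rewrite -[leRHS]mulrA ler_wpM2l.
Qed.

(** * Divergence, and passage from finite sums to series *)

Lemma sum_hbin_sqr_unbounded (R : realType) (N : nat) (K : R) :
  exists2 M, (N < M)%N & K < \sum_(m < M.+1) hbin R 0 m ^+ 2.
Proof.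
have hnd : {homo series (@harmonic R) : n m / (n <= m)%N >-> n <= m}.
  by apply/nondecreasing_seqP => n; rewrite seriesSr lerDl harmonic_ge0.
have [M0 _ HM] := (cvgryPgt _).1 (nondecreasing_dvgn_lt hnd (@dvg_harmonic R)) (4 * K).
pose M := (N.+1 + M0)%N.
have HK : 4 * K < series harmonic M by apply: HM; rewrite /= /M leq_addl.
exists M; first by rewrite /M; lia.
rewrite big_ord_recl /= -ltrBlDl.
apply: (@lt_le_trans _ _ (4^-1 * series harmonic M)).
  by rewrite hbin0 expr1n; lra.
rewrite seriesEord mulr_sumr; apply: ler_sum => i _.
by rewrite /= -invfM hbin0_sqr_lb.
Qed.

Lemma sum_ord_ler_tail0 (R : realType) (F : nat -> R) N X :
  (forall m, 0 <= F m) -> (forall m, (X <= m)%N -> F m = 0) ->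
  \sum_(m < N) F m <= \sum_(m < X) F m.
Proof.
move=> F0 FX.
have E n : \sum_(m < n) F m = \sum_(0 <= m < n) F m by rewrite big_mkord.
apply: (@le_trans _ _ (\sum_(m < X + N) F m)).
  rewrite !E [leRHS](@big_cat_nat _ _ _ N)//= ?leq_addl//.
  by rewrite lerDl sumr_ge0.
rewrite !E (@big_cat_nat _ _ _ X)//= ?leq_addr//.
by rewrite gerDl big_nat_cond big1// => m /andP[/andP[/FX]].
Qed.

Lemma lap_half_series_ub (R : realType) l M (u : nat -> R) (B : R) :
  (forall n, (M < n)%N -> u n = 0) ->
  \sum_(m < M.+1) `|iter l (@grad R) u (m + l)%N| ^+ 2 <= B ->
  (\sum_(0 <= n <oo | (l <= 2 * n)%N) (`|lap_half l u n| ^+ 2)%:E <= B%:E)%E.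
Proof.
move=> u0 HB; apply: lime_le.
  by apply: is_cvg_nneseries => n _ _; rewrite lee_fin sqr_ge0.
apply: nearW => N; rewrite sumEFin lee_fin; apply: le_trans HB.
(* The condition [l <= 2 * n] means [uphalf l <= n]. As [uphalf l + l./2 = l], putting
   [n = m + uphalf l] turns the point [n + l./2] of [lap_half_grad] into [m + l]. *)
rewrite (eq_bigl (fun n => true && (uphalf l <= n)%N)); last by move=> n /=; lia.
rewrite -big_nat_widenl// -[uphalf l]add0n big_addn.
rewrite (eq_bigr (fun m => `|iter l (@grad R) u (m + l)%N| ^+ 2)); last first.
  move=> m _; rewrite lap_half_grad; last by lia.
  by congr (`|iter _ _ _ _| ^+ 2); lia.
rewrite big_mkord; apply: (sum_ord_ler_tail0
  (F := fun m => `|iter l (@grad R) u (m + l)%N| ^+ 2)).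
  by move=> m; rewrite sqr_ge0.
move=> m Mm; rewrite (@iter_grad_shift_eq0 _ _ M.+1) ?normr0 ?expr0n//.
by rewrite leq_add2r.
Qed.

Lemma hardy_series_lb (R : realType) l M (u : nat -> R) :
  ((\sum_(m < M.+1) (u (m + l)%N ^+ 2 / (m + l)%:R ^+ (2 * l)))%:E
   <= \sum_(l <= n <oo) (u n ^+ 2 / n%:R ^+ (2 * l))%:E)%E.
Proof.
have nn n : 0 <= u n ^+ 2 / n%:R ^+ (2 * l) by rewrite divr_ge0 ?sqr_ge0 ?exprn_ge0.
apply: le_trans (nneseries_lim_ge (M.+1 + l) _); last by move=> n _ _; rewrite lee_fin.
by rewrite sumEFin -[X in index_iota X]add0n big_addn addnK big_mkord.
Qed.

(** * Optimality of the constant *)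

Theorem proposition4p1 (R : realType) (l : nat) (hl : (2 <= l)%N)
    (lambda : R) (hlambda : hardy_const R l < lambda) :
  ~ (forall u : nat -> R, finitely_supported u ->
      (forall k : nat, (k < l)%N -> u k = 0) ->
      (lambda%:E * (\sum_(l <= n <oo) (u n ^+ 2 / n%:R ^+ (2 * l))%:E)
       <= \sum_(0 <= n <oo | (l <= 2 * n)%N) (`|lap_half l u n| ^+ 2)%:E)%E).
Proof.
move=> H; set C := hardy_const R l in hlambda.
have C0 : 0 <= C by rewrite sqr_ge0.
have lambda0 : 0 < lambda by exact: le_lt_trans hlambda.
pose K2 : R := 4 * (8 * l.+1%:R) ^+ l + ((8 * l.+1%:R) ^+ l) ^+ 2.
pose K3 : R := 4 * l%:R * l.+1%:R + 2 * l%:R ^+ 2.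
(* Let S be the sum of the a_m^2 and T the truncated Hardy sum. From lambda T <= S + K2 and S - K3
   <= C T follows (lambda - C) S <= lambda K3 + C K2, which this choice of [M] violates. *)
have [M lM HM] := sum_hbin_sqr_unbounded l ((lambda * K3 + C * K2) / (lambda - C)).
have fin : finitely_supported (trial R l M).
  apply: (sub_finite_set _ (finite_II M.+1)) => n /= /eqP un.
  by rewrite ltnNge; apply/negP => /(@trial_eq0_ge R l) /un.
have ub := lap_half_series_ub (@trial_eq0_ge R l M) (sum_trial_grad_ub R lM).
have lb := sum_trial_lb R hl lM.
have := le_trans (H _ fin (@trial_eq0_lt R l M)) ub.
have l0E : (0 <= lambda%:E)%E by rewrite lee_fin ltW.
move=> /(le_trans (lee_wpmul2l l0E (hardy_series_lb l M _))).
rewrite -EFinM lee_fin -/K2; move: lb; rewrite -/C -/K3.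
move: HM; rewrite ltr_pdivrMr ?subr_gt0//.
move: (\sum_(m < M.+1) _) (\sum_(m < M.+1) _) K2 K3 => T S k2 k3 HM h3 h2.
have := ler_wpM2l C0 h2; have := ler_wpM2l (ltW lambda0) h3.
by rewrite [C * (lambda * _)]mulrCA; move: (lambda * (C * _)) HM => z; lra.
Qed.
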